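(* (a) There are infinite sets $A, B \subseteq \omega$ and a single relative c.e. operator $\Theta$ such that $\Theta(S) = A$ for every infinite $S \subseteq B$, but there is no infinite $C \subseteq B$ such that every infinite subset of $C$ computes $A$. (b) There are infinite sets $A, B \subseteq \omega$ and a single relative c.e. operator $\Theta$ such that $\Theta(S) = A$ for every infinite $S \subseteq B$, but there is no infinite $C \subseteq A$ such that every infinite subset of $B$ computes $C$.
   Context: A relative c.e. operator is a c.e. set $\Theta$ of pairs $(\sigma, x) \in 2^{<\omega}\times\omega$; for $X \subseteq \omega$ (identified with its characteristic function), $\Theta(X)$ is the set of $x$ for which there is $\sigma$ an initial segment of $X$ with $(\sigma,x) \in \Theta$. Thus $\Theta(S) = A$ for all infinite $S\subseteq B$ means that $A$ is c.e. in every infinite subset of $B$ via one fixed enumeration procedure. *)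

(* Defs.v *)
From Stdlib Require Import Arith List Lia.
Import ListNotations.

Definition setN := nat -> bool.

Definition infinite (X : setN) : Prop := forall n, exists m, n <= m /\ X m = true.
Definition subset (X Y : setN) : Prop := forall x, X x = true -> Y x = true.

(** Codes of partial mu-recursive functions with an oracle (arity-free:
    a code acts on a list of arguments). *)
Inductive code : Type :=
| CZero : code
| CSucc : code
| CProj : nat -> code
| COracle : code
| CComp : code -> list code -> code
| CPrimRec : code -> code -> code
| CMu : code -> code.

Inductive eval (X : setN) : code -> list nat -> nat -> Prop :=
| ev_zero : forall args, eval X CZero args 0
| ev_succ : forall args, eval X CSucc args (S (hd 0 args))
| ev_proj : forall i args, eval X (CProj i) args (nth i args 0)
| ev_oracle : forall args, eval X COracle args (if X (hd 0 args) then 1 else 0)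
| ev_comp : forall f gs args ys y,
    evals X gs args ys -> eval X f ys y -> eval X (CComp f gs) args y
| ev_prim0 : forall f g rest y,
    eval X f rest y -> eval X (CPrimRec f g) (0 :: rest) y
| ev_primS : forall f g n rest z y,
    eval X (CPrimRec f g) (n :: rest) z ->
    eval X g (n :: z :: rest) y ->
    eval X (CPrimRec f g) (S n :: rest) y
| ev_mu : forall f args n,
    eval X f (n :: args) 0 ->
    (forall m, m < n -> exists k, eval X f (m :: args) (S k)) ->
    eval X (CMu f) args n
with evals (X : setN) : list code -> list nat -> list nat -> Prop :=
| evs_nil : forall args, evals X [] args []
| evs_cons : forall g gs args y ys,
    eval X g args y -> evals X gs args ys -> evals X (g :: gs) args (y :: ys).

Definition computes (X A : setN) : Prop :=
  exists c, forall x, eval X c [x] (if A x then 1 else 0).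

Definition cpair (a b : nat) : nat := (a + b) * (a + b + 1) / 2 + b.
Fixpoint code_str (s : list bool) : nat :=
  match s with
  | [] => 0
  | b :: s' => S (cpair (if b then 1 else 0) (code_str s'))
  end.

(** A relative c.e. operator: a c.e. set of pairs (sigma, x) in 2^{<omega} x omega.
    c.e. = domain of a partial computable (oracle-free) function on the codes. *)
Definition ce_pairs (Theta : list bool -> nat -> Prop) : Prop :=
  exists c, forall sigma x,
    Theta sigma x <-> exists y, eval (fun _ => false) c [cpair (code_str sigma) x] y.

Definition rel_ce_operator (Theta : list bool -> nat -> Prop) : Prop := ce_pairs Theta.

Definition prefix (sigma : list bool) (X : setN) : Prop :=
  forall i, i < length sigma -> nth i sigma false = X i.

Definition apply_op (Theta : list bool -> nat -> Prop) (X : setN) (x : nat) : Prop :=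
  exists sigma, prefix sigma X /\ Theta sigma x.

(* Main.v *)
From Stdlib Require Import Arith List Lia Classical ClassicalEpsilon.
From mathcomp Require filter.
Require Import Defs.
Import ListNotations.
Local Open Scope bool_scope.

(** (a) Fix a nonprincipal ultrafilter [U] on the natural numbers. Every open set [O] of infinite
    sets is decided by [U]: either [U]-almost all choices of [n0], then [U]-almost all choices of
    [n1 > n0], etc., lead into [O], or almost all of them stay out of [O]. Let [A] be the set of
    the [x = <e, N>] such that almost all [S] satisfy [Phi_e(x) = 0] for the oracle consisting of
    the finite set coded by [N] followed by [S]. If the successive elements of [B] are chosen in
    the sets of [U] given by the elements chosen before, then all the infinite subsets of [B]
    follow the decisions of [U], so that no infinite [S <= B] computes [A] through [e]: take for
    [N] an initial segment of [S] and look at [x = <e, N>]. To make [A] enumerable from [S]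
    without a universal machine, [U] is taken to concentrate on the numbers whose binary digits
    list true facts "[Phi_e(x) = 0] with such a finite oracle".

    (b) Let every element of [B] enumerate into [A] the positions of its binary digits, and
    build [B] by finite approximations in such a way that almost every element of [B] enumerates
    any given element of [A]. If all infinite subsets of [B] compute [C <= A], then some [e] and
    some finite oracle compute [C] uniformly, in the sense that all finite extensions of this
    oracle inside [B] give correct answers and can be further extended to give an answer. When the
    construction of [B] considers [e], it looks for a fresh [y] accepted with an admissible oracle
    and then for an answer at [y] with an admissible oracle whose elements do not enumerate [y].
    If there is no such answer, or if it is positive, [y] is kept out of [A]; if it is negative,
    both oracles are put into [B] and give contradictory answers. *)

(** * Evaluation and codes *)

Section EvalInd.
Variables (X : setN) (P : code -> list nat -> nat -> Prop)
  (Q : list code -> list nat -> list nat -> Prop).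
Hypotheses (Hzero : forall args, P CZero args 0)
  (Hsucc : forall args, P CSucc args (S (hd 0 args)))
  (Hproj : forall i args, P (CProj i) args (nth i args 0))
  (Horacle : forall args, P COracle args (if X (hd 0 args) then 1 else 0))
  (Hcomp : forall f gs args ys y, Q gs args ys -> P f ys y -> P (CComp f gs) args y)
  (Hprim0 : forall f g rest y, P f rest y -> P (CPrimRec f g) (0 :: rest) y)
  (HprimS : forall f g n rest z y, P (CPrimRec f g) (n :: rest) z ->
     P g (n :: z :: rest) y -> P (CPrimRec f g) (S n :: rest) y)
  (Hmu : forall f args n, P f (n :: args) 0 ->
     (forall m, m < n -> exists k, P f (m :: args) (S k)) -> P (CMu f) args n)
  (Hnil : forall args, Q [] args [])
  (Hcons : forall g gs args y ys, P g args y -> Q gs args ys -> Q (g :: gs) args (y :: ys)).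

(* The generated scheme gives no induction hypothesis below the [exists] of [ev_mu]. *)
Fixpoint eval_nested_ind c args y (H : eval X c args y) {struct H} : P c args y :=
  match H in eval _ c args y return P c args y with
  | ev_zero a => Hzero a
  | ev_succ a => Hsucc a
  | ev_proj i a => Hproj i a
  | ev_oracle a => Horacle a
  | ev_comp f gs a ys y h1 h2 =>
      Hcomp f gs a ys y (evals_nested_ind gs a ys h1) (eval_nested_ind f ys y h2)
  | ev_prim0 f g r y h => Hprim0 f g r y (eval_nested_ind f r y h)
  | ev_primS f g n r z y h1 h2 =>
      HprimS f g n r z y (eval_nested_ind _ _ _ h1) (eval_nested_ind _ _ _ h2)
  | ev_mu f a n h1 h2 =>
      Hmu f a n (eval_nested_ind _ _ _ h1)
        (fun m lt => match h2 m lt with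
                     | ex_intro k hk => ex_intro _ k (eval_nested_ind _ _ _ hk) end)
  end
with evals_nested_ind gs args ys (H : evals X gs args ys) {struct H} : Q gs args ys :=
  match H in evals _ gs args ys return Q gs args ys with
  | evs_nil a => Hnil a
  | evs_cons g gs a y ys h1 h2 =>
      Hcons g gs a y ys (eval_nested_ind _ _ _ h1) (evals_nested_ind _ _ _ h2)
  end.
End EvalInd.

Lemma eval_deterministic X c args y y' : eval X c args y -> eval X c args y' -> y = y'.
Proof.
intros H; revert y'.
apply (eval_nested_ind X (fun c args y => forall y', eval X c args y' -> y = y')
  (fun gs args ys => forall ys', evals X gs args ys' -> ys = ys')); try exact H; clear.
1-4: intros; match goal with h : eval _ _ _ _ |- _ => inversion h; reflexivity end.
- intros f gs args ys y IHg IHf y' E; inversion E; subst.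
  match goal with h : evals _ _ _ _ |- _ => apply IHg in h; subst end; auto.
- intros f g rest y IH y' E; inversion E; subst; auto.
- intros f g n rest z y IH1 IH2 y' E; inversion E; subst.
  match goal with h : eval _ (CPrimRec _ _) _ _ |- _ => apply IH1 in h; subst end; auto.
- intros f args n IH0 IH y' E; inversion E as [| | | | | | |f' a' n' h0 h1]; subst.
  destruct (Nat.lt_trichotomy n y') as [lt|[eq|lt]]; auto.
  + destruct (h1 n lt) as [k hk]; apply IH0 in hk; discriminate.
  + destruct (IH y' lt) as [k hk]; apply hk in h0; discriminate.
- intros args ys E; inversion E; auto.
- intros g gs args y ys IH1 IH2 ys' E; inversion E; subst; f_equal; auto.
Qed.

Definition agree (m : nat) (X Y : setN) : Prop := forall k, k < m -> X k = Y k.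

Lemma agree_le m n X Y : m <= n -> agree n X Y -> agree m X Y.
Proof. intros le H k lt; apply H; lia. Qed.

(** Merges the uses of the finitely many computations that precede the result of a [CMu] search into
    one. *)
Lemma bounded_uniform (P : nat -> nat -> Prop) n :
  (forall m u v, u <= v -> P m u -> P m v) ->
  (forall m, m < n -> exists u, P m u) -> exists u, forall m, m < n -> P m u.
Proof.
intros mono; induction n as [|n IH]; intros H.
- exists 0; lia.
- destruct IH as [u Hu]; [intros m lt; apply H; lia|].
  destruct (H n) as [v Hv]; [lia|].
  exists (u + v); intros m lt; assert (m = n \/ m < n) as [->|lt'] by lia.
  + apply (mono _ v); auto; lia.
  + apply (mono _ u); auto; lia.
Qed.

(** The use principle: a derivation consults finitely many oracle bits, and the sum of the uses of
    the subcomputations bounds them all. *)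
Lemma eval_use X c args y : eval X c args y ->
  exists u, forall X', agree u X X' -> eval X' c args y.
Proof.
apply (eval_nested_ind X
  (fun c args y => exists u, forall X', agree u X X' -> eval X' c args y)
  (fun gs args ys => exists u, forall X', agree u X X' -> evals X' gs args ys)).
1-3: exists 0; intros; constructor.
- intros a; exists (S (hd 0 a)); intros X' H; rewrite (H (hd 0 a)) by lia; constructor.
- intros f gs a ys z [u Hu] [v Hv]; exists (u + v); intros X' H.
  apply ev_comp with ys; [apply Hu|apply Hv]; eapply agree_le; try exact H; lia.
- intros f g r z [u Hu]; exists u; intros; constructor; auto.
- intros f g n r z w [u Hu] [v Hv]; exists (u + v); intros X' H.
  apply ev_primS with z; [apply Hu|apply Hv]; eapply agree_le; try exact H; lia.
- intros f a n [u Hu] H.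
  destruct (bounded_uniform (fun m u => exists k, forall X', agree u X X' ->
     eval X' f (m :: a) (S k)) n) as [v Hv].
  + intros m p q le [k Hk]; exists k; intros X' h; apply Hk, (agree_le _ q); auto.
  + intros m lt; destruct (H m lt) as [k [w Hw]]; exists w, k; auto.
  + exists (u + v); intros X' h; constructor.
    * apply Hu, (agree_le _ (u + v)); auto; lia.
    * intros m lt; destruct (Hv m lt) as [k Hk]; exists k.
      apply Hk, (agree_le _ (u + v)); auto; lia.
- intros a; exists 0; intros; constructor.
- intros g gs a z zs [u Hu] [v Hv]; exists (u + v); intros X' H.
  constructor; [apply Hu|apply Hv]; eapply agree_le; try exact H; lia.
Qed.

(** * Cantor pairing and a numbering of the codes *)

Lemma triangle_succ n : S n * (S n + 1) / 2 = n * (n + 1) / 2 + S n.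
Proof.
replace (S n * (S n + 1)) with (n * (n + 1) + S n * 2) by lia.
apply Nat.div_add; lia.
Qed.

Lemma triangle_mono m n : m <= n -> m * (m + 1) / 2 <= n * (n + 1) / 2.
Proof. intros H; apply Nat.Div0.div_le_mono; nia. Qed.

Lemma cpair_mono a b a' b' : a <= a' -> b <= b' -> cpair a b <= cpair a' b'.
Proof.
intros; unfold cpair; generalize (triangle_mono (a + b) (a' + b')); lia.
Qed.

Lemma cpair_sum_lt a b a' b' : a + b < a' + b' -> cpair a b < cpair a' b'.
Proof.
intros H; unfold cpair.
generalize (triangle_mono (S (a + b)) (a' + b') H), (triangle_succ (a + b)); lia.
Qed.

Lemma cpair_inj a b a' b' : cpair a b = cpair a' b' -> a = a' /\ b = b'.
Proof.
intros H; destruct (Nat.lt_trichotomy (a + b) (a' + b')) as [h|[h|h]].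
- apply cpair_sum_lt in h; lia.
- unfold cpair in H; rewrite h in H; lia.
- apply cpair_sum_lt in h; lia.
Qed.

Lemma le_triangle n : n <= n * (n + 1) / 2.
Proof.
induction n as [|n IH]; [simpl; lia|]; rewrite triangle_succ; lia.
Qed.

Lemma cpair_ge a b : a <= cpair a b /\ b <= cpair a b.
Proof. unfold cpair; generalize (le_triangle (a + b)); lia. Qed.

Fixpoint enc (c : code) : nat :=
  match c with
  | CZero => cpair 0 0
  | CSucc => cpair 1 0
  | CProj i => cpair 2 i
  | COracle => cpair 3 0
  | CComp f gs => cpair 4 (cpair (enc f)
      ((fix encs l := match l with [] => 0 | g :: l' => S (cpair (enc g) (encs l')) end) gs))
  | CPrimRec f g => cpair 5 (cpair (enc f) (enc g))
  | CMu f => cpair 6 (enc f)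
  end.

Lemma enc_inj c d : enc c = enc d -> c = d.
Proof.
revert c d; fix IH 1; intros c d.
destruct c as [| |i| |f gs|f g|f], d as [| |i'| |f' gs'|f' g'|f']; simpl; intros H;
  apply cpair_inj in H as [H1 H]; try discriminate H1; clear H1;
  try reflexivity.
- subst; reflexivity.
- apply cpair_inj in H as [H1 H]; apply IH in H1; subst f'; f_equal.
  (* Codes are nested in lists: an inner induction runs along the list and calls [IH] on its
     members. *)
  revert gs' H; induction gs as [|g gs IHl]; intros [|g' gs'] H; try discriminate H; [reflexivity|].
  apply eq_add_S in H; apply cpair_inj in H as [H1 H]; apply IH in H1; subst g'; f_equal.
  apply IHl, H.
- apply cpair_inj in H as [H1 H]; apply IH in H1; apply IH in H; subst; reflexivity.
- apply IH in H; subst; reflexivity.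
Qed.

(** * Primitive recursive functions and the two operators *)

(** One code has to work for every oracle; only total computability on [k]-tuples is recorded, not a
    primitive recursive derivation. *)
Definition pr (k : nat) (f : list nat -> nat) : Prop :=
  exists c, forall X a, length a = k -> eval X c a (f a).

Lemma pr_ext k f g : (forall a, length a = k -> g a = f a) -> pr k f -> pr k g.
Proof. intros H [c Hc]; exists c; intros X a L; rewrite H; auto. Qed.

Lemma pr_nth k i : pr k (fun a => nth i a 0).
Proof. exists (CProj i); intros; constructor. Qed.

Lemma evals_of_pr k (gs : list (list nat -> nat)) : Forall (pr k) gs ->
  exists cs, forall X a, length a = k -> evals X cs a (map (fun g => g a) gs).
Proof.
induction 1 as [|g gs [c Hc] _ [cs Hcs]].
- exists []; intros; constructor.
- exists (c :: cs); intros; simpl; constructor; auto.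
Qed.

Lemma pr_comp m k f gs : pr m f -> Forall (pr k) gs -> length gs = m ->
  pr k (fun a => f (map (fun g => g a) gs)).
Proof.
intros [c Hc] H L; destruct (evals_of_pr k gs H) as [cs Hcs].
exists (CComp c cs); intros X a La; apply ev_comp with (map (fun g => g a) gs); auto.
apply Hc; rewrite length_map; auto.
Qed.

(** Used to pass arguments on through a composition by projections; the prefix [b] absorbs the heads
    of [a] in the induction. *)
Lemma map_nth_seq (b a : list nat) :
  map (fun g => g (b ++ a)) (map (fun i c => nth i c 0) (seq (length b) (length a))) = a.
Proof.
rewrite map_map; revert b; induction a as [|x a IH]; intros b; auto.
cbn [length seq map]; f_equal.
- rewrite app_nth2, Nat.sub_diag; auto.
- generalize (IH (b ++ [x])); rewrite <- app_assoc, length_app, Nat.add_1_r; auto.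
Qed.

Lemma Forall_pr_nth k l : Forall (pr k) (map (fun i c => nth i c 0) l).
Proof. induction l; simpl; constructor; auto using pr_nth. Qed.

Lemma pr_rec k f g h : pr k f -> pr (S (S k)) (fun a => g (nth 0 a 0) (nth 1 a 0) (tl (tl a))) ->
  pr k h -> pr k (fun a => nat_rect (fun _ => nat) (f a) (fun n z => g n z a) (h a)).
Proof.
intros [cf Hf] [cg Hg] Hh.
destruct (evals_of_pr k (h :: map (fun i c => nth i c 0) (seq 0 k))) as [cs Hcs].
{ constructor; auto using Forall_pr_nth. }
exists (CComp (CPrimRec cf cg) cs); intros X a L.
apply ev_comp with (h a :: a).
- specialize (Hcs X a L); generalize (map_nth_seq [] a); simpl in *.
  rewrite L; intros E; rewrite E in Hcs; exact Hcs.
- induction (h a) as [|n IH]; simpl; [constructor; auto|].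
  eapply ev_primS; [exact IH|]; apply Hg; simpl; auto.
Qed.

Lemma pr_tl k f : pr k f -> pr (S k) (fun a => f (tl a)).
Proof.
intros H; eapply pr_ext; [|apply (pr_comp k (S k) f
  (map (fun i c => nth i c 0) (seq 1 k)) H)]; auto using Forall_pr_nth.
- intros [|n a] [= L]; simpl; f_equal.
  generalize (map_nth_seq [n] a); simpl; rewrite L; auto.
- rewrite length_map, length_seq; auto.
Qed.

Lemma pr_0 k : pr k (fun _ => 0).
Proof. exists CZero; intros; constructor. Qed.

Lemma pr_S k f : pr k f -> pr k (fun a => S (f a)).
Proof.
intros H; apply (pr_comp 1 k (fun a => S (hd 0 a)) [f]); auto.
exists CSucc; intros; constructor.
Qed.

Lemma pr_hd k : pr k (fun a => hd 0 a).
Proof. apply (pr_ext _ (fun a => nth 0 a 0)); auto using pr_nth; intros [|]; auto. Qed.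

Lemma pr_const k n : pr k (fun _ => n).
Proof. induction n; [apply pr_0|apply (pr_S k (fun _ => n)); auto]. Qed.

Ltac pr_leaf := auto using pr_0, pr_const, pr_nth, pr_hd, pr_tl, pr_S.

Lemma pr_add k f g : pr k f -> pr k g -> pr k (fun a => f a + g a).
Proof.
intros Hf Hg; eapply pr_ext; [|apply (pr_rec k g (fun _ z _ => S z) f)]; pr_leaf.
intros a _; simpl; induction (f a); simpl; auto.
Qed.

Lemma pr_mul k f g : pr k f -> pr k g -> pr k (fun a => f a * g a).
Proof.
intros Hf Hg; eapply pr_ext; [|apply (pr_rec k (fun _ => 0) (fun _ z a => g a + z) f)]; pr_leaf.
- intros a _; simpl; induction (f a); simpl; auto.
- apply pr_add; pr_leaf; apply (pr_tl (S k) (fun a => g (tl a))); pr_leaf.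
Qed.

Lemma pr_pred k f : pr k f -> pr k (fun a => pred (f a)).
Proof.
intros Hf; eapply pr_ext; [|apply (pr_rec k (fun _ => 0) (fun n _ _ => n) f)]; pr_leaf.
intros a _; simpl; destruct (f a); simpl; auto.
Qed.

Lemma pr_sub k f g : pr k f -> pr k g -> pr k (fun a => f a - g a).
Proof.
intros Hf Hg; eapply pr_ext; [|apply (pr_rec k f (fun _ z _ => pred z) g)]; pr_leaf.
- intros a _; simpl; induction (g a); simpl; lia.
- apply pr_pred; pr_leaf.
Qed.

Lemma pr_pow2 k f : pr k f -> pr k (fun a => 2 ^ f a).
Proof.
intros Hf; eapply pr_ext; [|apply (pr_rec k (fun _ => 1) (fun _ z _ => z + z) f)]; pr_leaf.
- intros a _; simpl; induction (f a); simpl; lia.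
- apply pr_add; pr_leaf.
Qed.

(* The characteristic function takes the value 0 on the elements, as in [CMu]. *)
Definition prp (k : nat) (P : list nat -> Prop) : Prop :=
  exists f, pr k f /\ forall a, length a = k -> f a = 0 <-> P a.

Lemma prp_eq k f g : pr k f -> pr k g -> prp k (fun a => f a = g a).
Proof.
intros Hf Hg; exists (fun a => (f a - g a) + (g a - f a)); split; [|intros; lia].
apply pr_add; apply pr_sub; auto.
Qed.

Lemma prp_not k P : prp k P -> prp k (fun a => ~ P a).
Proof.
intros [f [Hf H]]; exists (fun a => 1 - f a); split; [apply pr_sub; pr_leaf|].
intros a L; rewrite <- (H a L); lia.
Qed.

Lemma prp_and k P Q : prp k P -> prp k Q -> prp k (fun a => P a /\ Q a).
Proof.
intros [f [Hf H]] [g [Hg H']]; exists (fun a => f a + g a); split; [apply pr_add; auto|].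
intros a L; rewrite <- (H a L), <- (H' a L); lia.
Qed.

Lemma prp_iff k P Q : (forall a, length a = k -> P a <-> Q a) -> prp k P -> prp k Q.
Proof. intros H [f [Hf H']]; exists f; split; auto; intros; rewrite <- H; auto. Qed.

Lemma prp_ex k h P : pr k h -> prp (S k) (fun a => P (hd 0 a) (tl a)) ->
  prp k (fun a => exists n, n < h a /\ P n a).
Proof.
intros Hh [f [Hf H]].
(* Truth is the value 0, so a bounded existential is a product, and the empty product 1 is false. *)
exists (fun a => nat_rect (fun _ => nat) 1 (fun n z => z * f (n :: a)) (h a)); split.
- apply (pr_rec k (fun _ => 1) (fun n z a => z * f (n :: a))); pr_leaf.
  apply pr_mul; pr_leaf.
  (* The arguments are [n :: z :: a]; the projections 0, 2, 3, ... skip the accumulator [z]. *)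
  apply (pr_ext _ (fun a => f (map (fun g => g a) (map (fun i c => nth i c 0) (0 :: seq 2 k))))).
  + intros [|n [|z a]] [= L]; simpl; do 2 f_equal.
    generalize (map_nth_seq [n; z] a); simpl; rewrite L; auto.
  + apply (pr_comp (S k)); auto using Forall_pr_nth.
    rewrite length_map; simpl; rewrite length_seq; auto.
- intros a L; induction (h a) as [|n IH]; simpl.
  + split; [discriminate|intros (n & lt & _); lia].
  + rewrite Nat.mul_eq_0, IH, (H (n :: a)) by (simpl; auto); simpl; split.
    * intros [(m & lt & Hm)|Hn]; [exists m|exists n]; auto.
    * intros (m & lt & Hm); assert (m = n \/ m < n) as [->|lt'] by lia; eauto.
Qed.

Lemma prp_all k h P : pr k h -> prp (S k) (fun a => P (hd 0 a) (tl a)) ->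
  prp k (fun a => forall n, n < h a -> P n a).
Proof.
intros Hh HP; apply (prp_iff k (fun a => ~ exists n, n < h a /\ ~ P n a)).
- intros a _; split.
  + intros H n lt; apply NNPP; intros HP'; eauto.
  + intros H (n & lt & HP'); auto.
- apply prp_not, (prp_ex k h (fun n a => ~ P n a)); auto.
  apply (prp_not (S k) (fun a => P (hd 0 a) (tl a))); auto.
Qed.

Lemma prp_imp k P Q : prp k P -> prp k Q -> prp k (fun a => P a -> Q a).
Proof.
intros HP HQ; apply (prp_iff k (fun a => ~ (P a /\ ~ Q a))); [intros; tauto|].
auto using prp_not, prp_and.
Qed.

(** Doubling removes the division, so that the graph of [cpair] becomes a polynomial equation. *)
Lemma cpair_eq a b z : cpair a b = z <-> z + z = (a + b) * (a + b + 1) + (b + b).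
Proof.
unfold cpair; assert (E : (a + b) * (a + b + 1) / 2 + (a + b) * (a + b + 1) / 2
  = (a + b) * (a + b + 1)); [|lia].
induction (a + b) as [|n IH]; auto; rewrite triangle_succ; lia.
Qed.

Lemma prp_cpair k f g h : pr k f -> pr k g -> pr k h -> prp k (fun a => cpair (f a) (g a) = h a).
Proof.
intros; eapply prp_iff; [intros; symmetry; apply cpair_eq|].
apply prp_eq; repeat first [apply pr_add | apply pr_mul | pr_leaf].
Qed.

(** Here [q] holds the digits above [i] and [r] those below; both are bounded, as [prp_ex]
    requires. *)
Lemma testbit_eq n i : Nat.testbit n i = true <->
  exists q, q < S n /\ exists r, r < 2 ^ i /\ n = q * (2 ^ i + 2 ^ i) + (2 ^ i + r).
Proof.
split.
- intros H; apply Nat.testbit_true in H.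
  assert (p : 2 ^ i <> 0) by (apply Nat.pow_nonzero; lia).
  exists (n / 2 ^ i / 2); split.
  + rewrite Nat.Div0.div_div; apply Nat.lt_succ_r, Nat.Div0.div_le_upper_bound; nia.
  + exists (n mod 2 ^ i); split; [apply Nat.mod_upper_bound; auto|].
    generalize (Nat.div_mod_eq n (2 ^ i)), (Nat.div_mod_eq (n / 2 ^ i) 2); nia.
- intros (q & _ & r & lt & E); apply Nat.testbit_true.
  replace (n / 2 ^ i) with (1 + q * 2).
  + rewrite Nat.Div0.mod_add; auto.
  + apply Nat.div_unique with r; nia.
Qed.

Lemma prp_testbit k f g : pr k f -> pr k g -> prp k (fun a => Nat.testbit (f a) (g a) = true).
Proof.
intros Hf Hg; eapply prp_iff; [intros; symmetry; apply testbit_eq|].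
apply (prp_ex k (fun a => S (f a)) (fun q a => exists r, r < 2 ^ g a /\
   f a = q * (2 ^ g a + 2 ^ g a) + (2 ^ g a + r))); pr_leaf.
apply (prp_ex (S k) (fun a => 2 ^ g (tl a)) (fun r a => 
   f (tl a) = hd 0 a * (2 ^ g (tl a) + 2 ^ g (tl a)) + (2 ^ g (tl a) + r))).
{ apply pr_pow2; pr_leaf. }
assert (H : forall h, pr k h -> pr (S (S k)) (fun a => h (tl (tl a)))).
{ intros h Hh; apply (pr_tl (S k) (fun a => h (tl a))); pr_leaf. }
apply prp_eq; repeat first [apply pr_add | apply pr_mul | apply pr_pow2]; pr_leaf.
Qed.

(** Decodes by searching the tail below [z]. The default 0 codes the empty string, whose tail is
    empty. *)
Definition code_tl (z : nat) : nat :=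
  nat_rect (fun _ => nat) 0
    (fun t r => if excluded_middle_informative (exists b, b < 2 /\ z = S (cpair b t))
                then t else r) z.

Lemma pr_code_tl k f : pr k f -> pr k (fun a => code_tl (f a)).
Proof.
intros Hf.
assert (H : prp (S (S k))
  (fun a => exists b, b < 2 /\ f (tl (tl a)) = S (cpair b (nth 0 a 0)))).
{ apply (prp_ex (S (S k)) (fun _ => 2)
    (fun b a => f (tl (tl a)) = S (cpair b (nth 0 a 0)))); pr_leaf.
  apply (prp_iff _ (fun a => S (pred (f (tl (tl (tl a))))) = f (tl (tl (tl a))) /\
     cpair (hd 0 a) (nth 0 (tl a) 0) = pred (f (tl (tl (tl a)))))).
  - intros; destruct (f _); simpl; lia.
  - assert (pr (S (S (S k))) (fun a => f (tl (tl (tl a))))).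
    { apply (pr_tl (S (S k)) (fun a => f (tl (tl a)))).
      apply (pr_tl (S k) (fun a => f (tl a))); pr_leaf. }
    apply prp_and; [apply prp_eq|apply prp_cpair]; auto using pr_pred; pr_leaf.
    * apply pr_S, pr_pred; auto.
    * apply (pr_tl (S (S k)) (fun a => nth 0 a 0)); pr_leaf. }
destruct H as [g [Hg H]].
(* The conditional in arithmetic form: [t] if [g] vanishes, [r] otherwise. *)
apply (pr_ext _ (fun a => nat_rect (fun _ => nat) 0
  (fun t r => t * (1 - g (t :: r :: a)) + r * (1 - (1 - g (t :: r :: a)))) (f a))).
- intros a L; unfold code_tl; match goal with |- nat_rect _ _ ?F _ = nat_rect _ _ ?G _ =>
    enough (E : forall m, nat_rect (fun _ => nat) 0 F m = nat_rect (fun _ => nat) 0 G m)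
      by apply E end.
  induction m as [|n IH]; auto; cbn [nat_rect]; rewrite IH.
  match goal with |- _ = n * (1 - g (n :: ?t :: a)) + _ => set (r := t) end.
  assert (Hv := H (n :: r :: a)); cbn [tl nth length] in Hv.
  destruct excluded_middle_informative as [h|h]; rewrite <- Hv in h by auto;
    destruct (g (n :: r :: a)); simpl; lia.
- apply (pr_rec k (fun _ => 0) (fun t r a => t * (1 - g (t :: r :: a)) +
    r * (1 - (1 - g (t :: r :: a)))) f); pr_leaf.
  assert (pr (S (S k)) (fun a => g (nth 0 a 0 :: nth 1 a 0 :: tl (tl a)))).
  { eapply pr_ext; [|exact Hg]; intros [|? [|? ?]] L; try discriminate L; auto. }
  repeat first [apply pr_add | apply pr_mul | apply pr_sub | pr_leaf].
Qed.

Lemma code_tl_code_str s : code_tl (code_str s) = code_str (tl s).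
Proof.
destruct s as [|b s]; auto; unfold code_tl; simpl code_str; simpl tl.
set (p := if b then 1 else 0); set (t := code_str s).
assert (Hp : p < 2) by (destruct b; unfold p; auto).
assert (H : t < S (cpair p t)) by (generalize (cpair_ge p t); lia).
match goal with |- nat_rect _ _ ?F _ = _ =>
  enough (E : forall m, t < m -> nat_rect (fun _ => nat) 0 F m = t) by apply E, H end.
clear H; induction m as [|m IH]; intros lt; [lia|]; simpl.
destruct excluded_middle_informative as [(b' & _ & E)|h].
- apply eq_add_S, cpair_inj in E; symmetry; apply E.
- assert (t = m \/ t < m) as [->|] by lia; auto.
  destruct h; eauto.
Qed.

(** After [i] symbols are dropped, the rest must be the code of a nonempty string with head
    [true]. *)
Definition code_bit (s i : nat) : Prop :=
  cpair 1 (code_tl (nat_rect (fun _ => nat) s (fun _ => code_tl) i)) =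
  pred (nat_rect (fun _ => nat) s (fun _ => code_tl) i) /\
  nat_rect (fun _ => nat) s (fun _ => code_tl) i <> 0.

Lemma code_bit_code_str s i : code_bit (code_str s) i <-> nth i s false = true.
Proof.
unfold code_bit.
replace (nat_rect (fun _ => nat) (code_str s) (fun _ => code_tl) i)
  with (code_str (skipn i s)).
- rewrite code_tl_code_str.
  replace (nth i s false) with (hd false (skipn i s)).
  + destruct (skipn i s) as [|[|] l]; simpl; split; intros H; try easy.
    destruct H as [H _]; apply cpair_inj in H; lia.
  + revert s; induction i; intros [|]; simpl; auto.
- induction i as [|i IH]; auto; simpl; rewrite <- IH, code_tl_code_str; f_equal.
  clear; revert s; induction i; intros [|? s]; auto; simpl in *.
  rewrite <- IHi; auto.
Qed.

Lemma prp_code_bit k f g : pr k f -> pr k g -> prp k (fun a => code_bit (f a) (g a)).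
Proof.
intros Hf Hg.
assert (pr k (fun a => nat_rect (fun _ => nat) (f a) (fun _ => code_tl) (g a))).
{ apply (pr_rec k f (fun _ z _ => code_tl z)); auto; apply pr_code_tl; pr_leaf. }
apply prp_and; [apply prp_cpair|apply prp_not, prp_eq];
  auto using pr_code_tl, pr_pred, pr_const.
Qed.

(** The characteristic function gets a search variable on which its vanishing does not depend: [CMu]
    stops at 0 if the relation holds, and never otherwise. *)
Lemma ce_pairs_of_prp P Theta : prp 2 (fun a => P (nth 0 a 0) (nth 1 a 0)) ->
  (forall s x, Theta s x <-> P (code_str s) x) -> ce_pairs Theta.
Proof.
intros HP H.
assert (D : prp 2 (fun a => exists s, s < S (nth 1 a 0) /\ exists x, x < S (nth 1 a 0) /\
   (cpair s x = nth 1 a 0 /\ P s x))).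
{ apply (prp_ex 2 (fun a => S (nth 1 a 0)) (fun s a => exists x, x < S (nth 1 a 0) /\
   (cpair s x = nth 1 a 0 /\ P s x))); pr_leaf.
  apply (prp_ex 3 (fun a => S (nth 1 (tl a) 0)) (fun x a =>
   (cpair (hd 0 a) x = nth 1 (tl a) 0 /\ P (hd 0 a) x))).
  { apply pr_S, (pr_tl 2 (fun a => nth 1 a 0)); pr_leaf. }
  apply prp_and.
  - apply prp_cpair; pr_leaf.
    apply (pr_tl 3 (fun a => nth 1 (tl a) 0)), (pr_tl 2 (fun a => nth 1 a 0)); pr_leaf.
  - destruct HP as [f [Hf E]].
    (* The inner variable [x] heads the list, whereas [f] expects [s] first. *)
    exists (fun a => f (map (fun g => g a) [fun a => nth 1 a 0; fun a => nth 0 a 0])); split.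
    + apply (pr_comp 2); auto using pr_nth.
    + intros [|y [|z a]] L; try discriminate L; rewrite E; simpl; tauto. }
destruct D as [f [[c Hc] D]]; exists (CMu c); intros s x.
set (z := cpair (code_str s) x).
assert (E : Theta s x <-> f [0; z] = 0).
{ rewrite D, H by auto; simpl; split.
  - intros Hx; exists (code_str s); generalize (cpair_ge (code_str s) x); fold z; split; [lia|].
    exists x; repeat split; auto; lia.
  - intros (s' & _ & x' & _ & E & Hx); apply cpair_inj in E as [-> ->]; auto. }
rewrite E; split.
- intros E0; exists 0; constructor; [|lia].
  generalize (Hc (fun _ => false) [0; z] eq_refl); rewrite E0; auto.
- intros [y Hy]; inversion Hy as [| | | | | | |f' a' n' h0 h1]; subst.
  apply (eval_deterministic _ _ _ _ (f [y; z])) in h0; [|apply Hc; auto].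
  symmetry in h0; rewrite D in h0 by auto; rewrite D by auto; exact h0.
Qed.

Lemma testbit_lt n i : Nat.testbit n i = true -> i < n.
Proof.
intros H; destruct (le_lt_dec n i) as [le|lt]; auto.
destruct n as [|n]; [rewrite Nat.bits_0 in H; discriminate|].
rewrite Nat.bits_above_log2 in H; [discriminate|].
generalize (Nat.log2_lt_lin (S n)); lia.
Qed.

Lemma nth_true_lt (s : list bool) j : nth j s false = true -> j < length s.
Proof.
intros H; destruct (le_lt_dec (length s) j); auto; rewrite nth_overflow in H; auto; discriminate.
Qed.

Lemma length_le_code_str s : length s <= code_str s.
Proof.
induction s as [|b s IH]; simpl; auto.
generalize (cpair_ge (if b then 1 else 0) (code_str s)); lia.
Qed.

Definition union_op (s : list bool) (x : nat) : Prop :=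
  exists j, nth j s false = true /\ Nat.testbit j x = true.

(* An element [j] of the oracle carries facts [cpair x N]: "enumerate [x] once the finite
   set coded by the bits of [N] is contained in the oracle". Facts only use the even digits of
   [j], so that every finite list of facts has arbitrarily large [j] carrying it. *)
Definition fact_op (s : list bool) (x : nat) : Prop :=
  exists j, nth j s false = true /\ exists N, Nat.testbit j (cpair x N + cpair x N) = true /\
  forall i, Nat.testbit N i = true -> nth i s false = true.

Lemma union_op_ce : rel_ce_operator union_op.
Proof.
apply (ce_pairs_of_prp (fun s x => exists j, j < s /\ (code_bit s j /\ Nat.testbit j x = true))).
- apply (prp_ex 2 (fun a => nth 0 a 0)
    (fun j a => code_bit (nth 0 a 0) j /\ Nat.testbit j (nth 1 a 0) = true)); pr_leaf.
  apply prp_and; [apply prp_code_bit|apply prp_testbit]; pr_leaf;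
    [apply (pr_tl 2 (fun a => nth 0 a 0))|apply (pr_tl 2 (fun a => nth 1 a 0))]; pr_leaf.
- intros s x; split.
  + intros (j & Hj & Hx); exists j; rewrite code_bit_code_str; repeat split; auto.
    generalize (length_le_code_str s); apply nth_true_lt in Hj; lia.
  + intros (j & _ & Hj & Hx); exists j; rewrite code_bit_code_str in Hj; auto.
Qed.

Lemma fact_op_ce : rel_ce_operator fact_op.
Proof.
(* Digit positions of [j] lie below [j], which bounds [N] and [w]; [w] names [cpair x N], so that
   the graph of the pairing suffices. *)
apply (ce_pairs_of_prp (fun s x => exists j, j < s /\ (code_bit s j /\ exists N, N < j /\
  ((exists w, w < j /\ (cpair x N = w /\ Nat.testbit j (w + w) = true)) /\
   forall i, i < N -> (Nat.testbit N i = true -> code_bit s i))))).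
- apply (prp_ex 2 (fun a => nth 0 a 0) (fun j a => code_bit (nth 0 a 0) j /\
    exists N, N < j /\
  ((exists w, w < j /\ (cpair (nth 1 a 0) N = w /\ Nat.testbit j (w + w) = true)) /\
   forall i, i < N -> (Nat.testbit N i = true -> code_bit (nth 0 a 0) i)))); pr_leaf.
  assert (V : forall k i, pr (S k) (fun a => nth i (tl a) 0)).
  { intros k i; apply (pr_tl k (fun a => nth i a 0)); pr_leaf. }
  assert (V2 : forall k i, pr (S (S k)) (fun a => nth i (tl (tl a)) 0)).
  { intros k i; apply (pr_tl (S k) (fun a => nth i (tl a) 0)); auto. }
  assert (V3 : forall k i, pr (S (S (S k))) (fun a => nth i (tl (tl (tl a))) 0)).
  { intros k i; apply (pr_tl (S (S k)) (fun a => nth i (tl (tl a)) 0)); auto. }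
  assert (H1 : forall k, pr (S k) (fun a => hd 0 (tl a))).
  { intros k; apply (pr_tl k (hd 0)); pr_leaf. }
  assert (H2 : forall k, pr (S (S k)) (fun a => hd 0 (tl (tl a)))).
  { intros k; apply (pr_tl (S k) (fun a => hd 0 (tl a))); auto. }
  apply prp_and; [apply prp_code_bit; pr_leaf|].
  apply (prp_ex 3 (hd 0) (fun N a =>
  ((exists w, w < hd 0 a /\
     (cpair (nth 1 (tl a) 0) N = w /\ Nat.testbit (hd 0 a) (w + w) = true)) /\
   forall i, i < N -> (Nat.testbit N i = true -> code_bit (nth 0 (tl a) 0) i)))); pr_leaf.
  apply prp_and.
  + apply (prp_ex 4 (fun a => hd 0 (tl a)) (fun w a => cpair (nth 1 (tl (tl a)) 0) (hd 0 a) = w /\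
     Nat.testbit (hd 0 (tl a)) (w + w) = true)); auto.
    apply prp_and; [apply prp_cpair|apply prp_testbit]; auto using pr_hd, pr_add.
  + apply (prp_all 4 (hd 0) (fun i a => Nat.testbit (hd 0 a) i = true ->
      code_bit (nth 0 (tl (tl a)) 0) i)); pr_leaf.
    apply prp_imp; [apply prp_testbit|apply prp_code_bit]; auto using pr_hd.
- intros s x; split.
  + intros (j & Hj & N & HN & Hs); exists j; rewrite code_bit_code_str; repeat split; auto.
    * generalize (length_le_code_str s); apply nth_true_lt in Hj; lia.
    * generalize (testbit_lt _ _ HN), (cpair_ge x N); intros.
      exists N; split; [lia|split; [|intros i _ Hi; apply code_bit_code_str; auto]].
      exists (cpair x N); repeat split; auto; lia.
  + intros (j & _ & Hj & N & _ & (w & _ & <- & HN) & Hs).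
    exists j; rewrite code_bit_code_str in Hj; split; auto; exists N; split; auto.
    intros i Hi; apply code_bit_code_str, Hs; auto using testbit_lt.
Qed.

(** * Part (b): finite approximations *)

Definition decide (P : Prop) : bool := if excluded_middle_informative P then true else false.

Lemma decideP P : decide P = true <-> P.
Proof. unfold decide; destruct excluded_middle_informative; split; easy. Qed.

Lemma nat_of_finite (P : nat -> Prop) n :
  exists N, forall k, Nat.testbit N k = true <-> k < n /\ P k.
Proof.
induction n as [|n [N IH]].
- exists 0; intros k; rewrite Nat.bits_0; split; [discriminate|lia].
- destruct (classic (P n)) as [HP|HP].
  + exists (Nat.setbit N n); intros k; rewrite Nat.setbit_eqb, Bool.orb_true_iff, IH,
      Nat.eqb_eq.
    split; [intros [<-|[lt Hk]]; auto|].
    intros [lt Hk]; assert (n = k \/ k < n) as [->|] by lia; auto.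
  + exists N; intros k; rewrite IH; split; intros [lt Hk]; split; auto.
    assert (n = k \/ k < n) as [->|] by lia; [contradiction|auto].
Qed.

Lemma prefix_map_seq (X : setN) n : prefix (map X (seq 0 n)) X.
Proof.
intros i lt; rewrite length_map, length_seq in lt.
rewrite nth_indep with (d' := X 0) by (rewrite length_map, length_seq; auto).
rewrite map_nth, seq_nth; auto.
Qed.

Lemma prefix_nth s X i : prefix s X -> nth i s false = true -> X i = true.
Proof. intros H Hi; rewrite <- H; auto using nth_true_lt. Qed.

Lemma nth_map_seq (X : setN) n i : i < n -> X i = true -> nth i (map X (seq 0 n)) false = true.
Proof.
intros lt H; rewrite (prefix_map_seq X n i); auto; rewrite length_map, length_seq; auto.
Qed.

Lemma apply_union_op S x :
  apply_op union_op S x <-> exists j, S j = true /\ Nat.testbit j x = true.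
Proof.
split.
- intros (s & Hs & j & Hj & Hx); exists j; eauto using prefix_nth.
- intros (j & Hj & Hx); exists (map S (seq 0 (j + 1))); split; auto using prefix_map_seq.
  exists j; split; auto; apply nth_map_seq; auto; lia.
Qed.

Lemma apply_fact_op S x : apply_op fact_op S x <->
  exists j N, S j = true /\ Nat.testbit j (cpair x N + cpair x N) = true /\
  forall i, Nat.testbit N i = true -> S i = true.
Proof.
split.
- intros (s & Hs & j & Hj & N & HN & Hx); exists j, N; repeat split; eauto using prefix_nth.
- intros (j & N & Hj & HN & Hx); exists (map S (seq 0 (j + N + 1))).
  split; auto using prefix_map_seq.
  exists j; split; [apply nth_map_seq; auto; lia|]; exists N; split; auto.
  intros i Hi; apply nth_map_seq; auto; apply testbit_lt in Hi; lia.
Qed.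

Lemma choice {A B : Type} (R : A -> B -> Prop) :
  (forall x, exists y, R x y) -> exists f, forall x, R x (f x).
Proof.
intros H; exists (fun x => proj1_sig (constructive_indefinite_description _ (H x))).
intros x; apply proj2_sig.
Qed.

Lemma sequence_of_steps {T : Type} (R : nat -> T -> T -> Prop) p :
  (forall t p, exists q, R t p q) ->
  exists s, s 0 = p /\ forall t : nat, R t (s t) (s (S t)).
Proof.
intros H; destruct (choice (fun u q => R (fst u) (snd u) q)) as [f Hf].
{ intros [t u]; apply H. }
exists (nat_rect (fun _ => T) p (fun t u => f (t, u))); split; auto.
intros t; apply (Hf (t, _)).
Qed.

Lemma list_bound (l : list nat) : exists n, forall x, In x l -> x < n.
Proof.
induction l as [|a l [n IH]]; [exists 0; easy|].
exists (a + n + 1); intros x [->|H]; [lia|]; apply IH in H; lia.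
Qed.

(** A pair [X], [m] stands for the string of the first [m] values of [X]; the computation has use at
    most [m]. *)
Definition conv (e : code) (X : setN) (m y v : nat) : Prop :=
  forall X', agree m X X' -> eval X' e [y] v.

(** Extension as in Mathias forcing, with [L] as the reservoir of new elements. *)
Definition string_ext (L : nat -> Prop) (X : setN) (m : nat) (Y : setN) (n : nat) : Prop :=
  m <= n /\ agree m X Y /\ forall k, m <= k < n -> Y k = true -> L k.

Lemma string_ext_imp (L L' : nat -> Prop) X m Y n :
  (forall k, m <= k -> L k -> L' k) -> string_ext L X m Y n -> string_ext L' X m Y n.
Proof.
intros H (h1 & h2 & h3); repeat split; auto; intros k lt Hk; apply H; auto; lia.
Qed.

Lemma string_ext_refl L X m : string_ext L X m X m.
Proof. repeat split; auto; lia. Qed.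

Lemma string_ext_trans L X m Y n Z p :
  string_ext L X m Y n -> string_ext L Y n Z p -> string_ext L X m Z p.
Proof.
intros (h1 & h2 & h3) (h4 & h5 & h6); repeat split; [lia| |].
- intros k lt; rewrite h2, h5; auto; lia.
- intros k lt Hk; destruct (le_lt_dec n k); [apply h6; auto; lia|].
  apply h3; [lia|]; rewrite h5; auto.
Qed.

Lemma conv_ext e L X m Y n y v : string_ext L X m Y n -> conv e X m y v -> conv e Y n y v.
Proof.
intros (h1 & h2 & _) H X' HX'; apply H; intros k lt; rewrite h2, HX'; auto; lia.
Qed.

(* A finite approximation to [B] (and thereby to [A], the union of the bit sets of the elements
   of [B]), together with finitely many numbers kept out of [A]. *)
Record state : Type := State { elts : list nat; outs : list nat; bound : nat }.

(** By the last clause later elements repeat all digits of the earlier ones, so that every infinite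
    subset of [B] enumerates all of [A]. *)
Definition legal (p : state) (b : nat) : Prop :=
  bound p <= b /\ (forall x, In x (outs p) -> Nat.testbit b x = false) /\
  (forall c x, In c (elts p) -> Nat.testbit c x = true -> Nat.testbit b x = true).

Definition valid (p : state) : Prop :=
  forall b, In b (elts p) -> b < bound p /\ forall x, In x (outs p) -> Nat.testbit b x = false.

Definition state_ext (p q : state) : Prop :=
  incl (elts p) (elts q) /\ incl (outs p) (outs q) /\ bound p <= bound q /\
  forall b, In b (elts q) -> In b (elts p) \/ legal p b.

Lemma legal_ext p q b : state_ext p q -> legal q b -> legal p b.
Proof.
intros (h1 & h2 & h3 & _) (l1 & l2 & l3); repeat split; eauto; lia.
Qed.

Lemma state_ext_refl p : state_ext p p.
Proof. repeat split; auto using incl_refl. Qed.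

Lemma state_ext_trans p q r : state_ext p q -> state_ext q r -> state_ext p r.
Proof.
intros H H'; generalize H H'; intros (h1 & h2 & h3 & h4) (k1 & k2 & k3 & k4).
repeat split; eauto using incl_tran; [lia|].
intros b Hb; destruct (k4 b Hb) as [Hq|Hq]; eauto using legal_ext.
Qed.

(** Elements added together need not be legal for one another; this lets two strings with different
    digits enter at once. *)
Lemma add_elements p l m : valid p -> (forall b, In b l -> legal p b /\ b < m) ->
  let q := State (l ++ elts p) (outs p) (bound p + m) in valid q /\ state_ext p q.
Proof.
intros V H q; split.
- intros b Hb; simpl in *; apply in_app_or in Hb as [Hb|Hb].
  + destruct (H b Hb) as [(_ & Ho & _) lt]; split; auto; lia.
  + destruct (V b Hb); split; auto; lia.
- repeat split; simpl; auto using incl_refl, incl_appr; [lia|].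
  intros b Hb; apply in_app_or in Hb as [Hb|Hb]; auto; right; apply H; auto.
Qed.

Lemma add_out p y : valid p -> (forall c, In c (elts p) -> Nat.testbit c y = false) ->
  let q := State (elts p) (y :: outs p) (bound p) in valid q /\ state_ext p q.
Proof.
intros V H q; split.
- intros b Hb; destruct (V b Hb); split; auto; intros x [<-|Hx]; auto.
- repeat split; simpl; auto using incl_refl, incl_tl.
Qed.

Lemma grow_state p : valid p -> exists q, valid q /\ state_ext p q /\ bound p < bound q /\
  exists b x, In b (elts q) /\ bound p <= b /\ bound p <= x /\ Nat.testbit b x = true.
Proof.
intros V; destruct (list_bound (outs p)) as [o Ho].
(* The digit [K] lies beyond all excluded numbers; it makes [b] large and puts a large number into
   [A]. *)
set (K := bound p + o).
destruct (nat_of_finite (fun k => k = K \/ exists c, In c (elts p) /\ Nat.testbit c k = true)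
  (K + 1)) as [b Hb].
assert (HK : Nat.testbit b K = true) by (apply Hb; split; [lia|auto]).
assert (K < b) by (apply testbit_lt in HK; auto).
assert (L : legal p b).
{ repeat split; [lia| |].
  - intros x Hx; destruct (Nat.testbit b x) eqn:E; auto; exfalso.
    apply Hb in E as [_ [->|(c & Hc & Hcx)]].
    + apply Ho in Hx; lia.
    + rewrite (proj2 (V c Hc)) in Hcx; easy.
  - intros c x Hc Hcx; apply Hb; split; eauto.
    apply testbit_lt in Hcx; destruct (V c Hc); lia. }
destruct (add_elements p [b] (b + 1) V) as [Vq Eq].
{ intros c [<-|[]]; split; auto; lia. }
eexists; split; [exact Vq|split; [exact Eq|split]]; simpl; [lia|].
exists b, K; repeat split; auto; lia.
Qed.

(** Legal elements start at the bound of the state, so a shorter string is first prolonged by zeros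
    up to it. *)
Definition pad (X : setN) (m : nat) : setN := fun k => (k <? m) && X k.

Lemma pad_lt X m k : k < m -> pad X m k = X k.
Proof. unfold pad; intros lt; apply Nat.ltb_lt in lt; rewrite lt; auto. Qed.

Lemma pad_ge X m k : m <= k -> pad X m k = false.
Proof. unfold pad; intros le; apply Nat.ltb_ge in le; rewrite le; auto. Qed.

(* The ways of ensuring that [e], run on the oracle sets extending [X 0 ... X (m - 1)], does
   not uniformly compute an infinite subset of [A]: it accepts no fresh [y]; it diverges at some
   [y] once [y] is kept out of [A]; it accepts some [y] kept out of [A]; it gives different
   answers for different oracles. *)
Definition settles (e : code) (X : setN) (m : nat) (p q : state) : Prop :=
  let ext L := string_ext L (pad X m) (max m (bound p)) in
  (forall y Y n, ext (legal p) Y n -> ~ In y (outs p) ->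
     (forall c, In c (elts p) -> Nat.testbit c y = false) -> ~ conv e Y n y 1) \/
  (exists y, In y (outs q) /\ forall Y n v,
     ext (fun k => legal p k /\ Nat.testbit k y = false) Y n -> ~ conv e Y n y v) \/
  (exists y Y n, In y (outs q) /\ ext (fun k => In k (elts q)) Y n /\ conv e Y n y 1) \/
  (exists y Y n Y' n' v, ext (fun k => In k (elts q)) Y n /\ conv e Y n y 1 /\
     ext (fun k => In k (elts q)) Y' n' /\ conv e Y' n' y v /\ v <> 1).

Lemma settles_ext e X m p q r : settles e X m p q -> state_ext q r -> settles e X m p r.
Proof.
intros H (h1 & h2 & _); unfold settles in *.
assert (I : forall Y n, string_ext (fun k => In k (elts q)) (pad X m) (max m (bound p)) Y n ->
  string_ext (fun k => In k (elts r)) (pad X m) (max m (bound p)) Y n).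
{ intros Y n; apply string_ext_imp; auto. }
destruct H as [H|[(y & Hy & H)|[(y & Y & n & Hy & H1 & H2)|
  (y & Y & n & Y' & n' & v & H1 & H2 & H3 & H4)]]]; auto.
- right; left; eauto.
- do 2 right; left; exists y, Y, n; auto.
- do 3 right; exists y, Y, n, Y', n', v; auto.
Qed.

Lemma add_strings p X m Y n Y' n' : valid p -> bound p <= m ->
  string_ext (legal p) X m Y n -> string_ext (legal p) X m Y' n' ->
  exists q, valid q /\ state_ext p q /\ string_ext (fun k => In k (elts q)) X m Y n /\
  string_ext (fun k => In k (elts q)) X m Y' n' /\ outs q = outs p /\
  forall k, In k (elts q) -> In k (elts p) \/ m <= k < n /\ Y k = true \/
    m <= k < n' /\ Y' k = true.
Proof.
intros V le H H'.
set (new Y n := filter Y (seq m (n - m))).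
assert (E : forall Y n k, In k (new Y n) <-> m <= k < n /\ Y k = true).
{ intros Z i k; unfold new; rewrite filter_In, in_seq; split; intros [h1 h2]; split; auto; lia. }
destruct (add_elements p (new Y n ++ new Y' n') (n + n') V) as [Vq Eq].
{ intros b Hb; apply in_app_or in Hb; rewrite !E in Hb.
  destruct H as (_ & _ & H), H' as (_ & _ & H').
  destruct Hb as [Hb|Hb]; split; [apply H|lia|apply H'|lia]; apply Hb. }
eexists; split; [exact Vq|split; [exact Eq|]]; simpl; repeat split; auto.
1,4: apply H || apply H'.
1,3: apply H || apply H'.
- intros k lt Hk; rewrite !in_app_iff, !E; auto.
- intros k lt Hk; rewrite !in_app_iff, !E; auto.
- intros k Hk; rewrite !in_app_iff, !E in Hk; tauto.
Qed.

Lemma settle e X m p : valid p -> exists q, valid q /\ state_ext p q /\ settles e X m p q.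
Proof.
intros V; unfold settles; set (M := max m (bound p)).
destruct (classic (exists y Y n, string_ext (legal p) (pad X m) M Y n /\ ~ In y (outs p) /\
  (forall c, In c (elts p) -> Nat.testbit c y = false) /\ conv e Y n y 1))
  as [(y & Y & n & HY & Hy & Hc & HC)|H].
2:{ exists p; split; [auto|split; [apply state_ext_refl|left]].
    intros y Y n h1 h2 h3 h4; apply H; exists y, Y, n; auto. }
destruct (classic (exists Y v n, string_ext (fun k => legal p k /\ Nat.testbit k y = false)
  (pad X m) M Y n /\ conv e Y n y v)) as [(Y' & v & n' & HY' & HC')|H].
(* No answer at [y] without enumerating [y]: once [y] is excluded, [e] diverges there. *)
2:{ destruct (add_out p y V Hc) as [Vq Eq].
    eexists; split; [exact Vq|split; [exact Eq|right; left]].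
    exists y; split; [simpl; auto|]; intros Z k v h1 h2; apply H; exists Z, v, k; auto. }
assert (HL : string_ext (legal p) (pad X m) M Y' n').
{ revert HY'; apply string_ext_imp; tauto. }
(* If [Y'] accepts too, its elements lack the digit [y], which can still be excluded. Otherwise [Y]
   and [Y'] disagree and both go in. *)
destruct (Nat.eq_dec v 1) as [->|ne].
- destruct (add_strings p (pad X m) M Y' n' Y' n' V) as
    (q & Vq & Eq & Sq & _ & Oq & Hq); auto; [lia|].
  destruct (add_out q y Vq) as [Vr Er].
  { intros c Hcq; destruct HY' as (_ & _ & HY').
    destruct (Hq c Hcq) as [h|[h|h]]; auto; apply HY'; apply h. }
  eexists; split; [exact Vr|split; [eapply state_ext_trans; eauto|do 2 right; left]].
  exists y, Y', n'; simpl; auto.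
- destruct (add_strings p (pad X m) M Y n Y' n' V) as
    (q & Vq & Eq & Sq & Sq' & Oq & Hq); auto; [lia|].
  exists q; split; [auto|split; [auto|do 3 right]].
  exists y, Y, n, Y', n', v; auto.
Qed.

(* Otherwise a set generic for finite extension inside [B] is an infinite subset of [B] that
   does not compute [C]. *)
Lemma uniform_computation (B C : setN) : infinite B ->
  (forall S, infinite S -> subset S B -> computes S C) ->
  exists e X m, (forall k, k < m -> X k = true -> B k = true) /\
  (forall Y n y v, string_ext (fun k => B k = true) X m Y n -> conv e Y n y v ->
     v = if C y then 1 else 0) /\
  (forall Y n y, string_ext (fun k => B k = true) X m Y n -> exists Y' n' v,
     string_ext (fun k => B k = true) Y n Y' n' /\ conv e Y' n' y v).
Proof.
intros HB HC; set (ext := string_ext (fun k => B k = true)).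
apply NNPP; intros NG.
(* The string forces [e] to fail at some [y]: by a wrong answer, or because no extension gives any
   answer. *)
set (Kill e Y n := exists y, (exists v, v <> (if C y then 1 else 0) /\ conv e Y n y v) \/
  forall Y' n' v, ext Y n Y' n' -> ~ conv e Y' n' y v).
assert (K : forall e X m, (forall k, k < m -> X k = true -> B k = true) ->
  exists Y n, ext X m Y n /\ Kill e Y n).
{ intros e X m HX; apply NNPP; intros NK; apply NG; exists e, X, m; split; [auto|split].
  - intros Y n y v HY Hv; apply NNPP; intros ne; apply NK; exists Y, n; split; auto.
    exists y; left; exists v; auto.
  - intros Y n y HY; apply NNPP; intros NC; apply NK; exists Y, n; split; auto.
    exists y; right; intros Y' n' v h1 h2; apply NC; exists Y', n', v; auto. }
assert (KE : forall e X m Y n, ext X m Y n -> Kill e X m -> Kill e Y n).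
{ intros e X m Y n E (y & [(v & ne & Hv)|H]); exists y; [left|right].
  - exists v; split; auto; eapply conv_ext; eauto.
  - intros Y' n' v E'; apply H; eapply string_ext_trans; eauto. }
set (sub (p : setN * nat) := forall k, k < snd p -> fst p k = true -> B k = true).
assert (SE : forall p q, sub p -> ext (fst p) (snd p) (fst q) (snd q) -> sub q).
{ intros p q Hp (h1 & h2 & h3) k lt Hk; destruct (le_lt_dec (snd p) k) as [le|lt'].
  - apply h3; auto.
  - apply Hp; auto; rewrite h2; auto. }
destruct (sequence_of_steps (fun t p q => sub p -> ext (fst p) (snd p) (fst q) (snd q) /\
  (exists k, snd p <= k < snd q /\ fst q k = true) /\
  forall e, t = enc e -> Kill e (fst q) (snd q)) (fun _ => false, 0)) as [s [s0 Hs]].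
{ intros t [X m].
  assert (H : exists q, sub (X, m) -> ext X m (fst q) (snd q) /\
    forall e, t = enc e -> Kill e (fst q) (snd q)).
  { destruct (classic (exists e, t = enc e)) as [[e ->]|H].
    - destruct (classic (sub (X, m))) as [HX|HX]; [|exists (X, m); tauto].
      destruct (K e X m HX) as (Y & n & HY & HK); exists (Y, n); intros _; split; auto.
      intros e' E; apply enc_inj in E; subst; auto.
    - exists (X, m); intros _; split; [apply string_ext_refl|].
      intros e E; exfalso; eauto. }
  destruct H as [[Y n] H]; simpl in H.
  destruct (HB n) as [b [le Hb]].
  assert (E : ext Y n (fun k => (k =? b) || pad Y n k) (b + 1)).
  { repeat split; [lia| |].
    - intros k lt; rewrite pad_lt by auto; assert (h : k <> b) by lia.
      apply Nat.eqb_neq in h; rewrite h; auto.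
    - intros k lt; rewrite pad_ge by lia; rewrite Bool.orb_false_r, Nat.eqb_eq.
      intros ->; auto. }
  exists (fun k => (k =? b) || pad Y n k, b + 1); simpl; intros HX.
  destruct (H HX) as [HE HK]; split; [eapply string_ext_trans; eauto|split].
  - exists b; rewrite Nat.eqb_refl; destruct HE; split; auto; lia.
  - intros e ->; eapply KE; eauto. }
assert (Hsub : forall t, sub (s t)).
{ induction t as [|t IH]; [rewrite s0; intros k lt; simpl in lt; lia|].
  apply (SE (s t)); auto; apply Hs; auto. }
assert (Hext : forall t u, t <= u -> ext (fst (s t)) (snd (s t)) (fst (s u)) (snd (s u))).
{ induction 1 as [|u le IH]; [apply string_ext_refl|].
  eapply string_ext_trans; [exact IH|]; apply Hs; auto. }
assert (Hlen : forall t, t <= snd (s t)).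
{ induction t as [|t IH]; [lia|]; destruct (Hs t (Hsub t)) as (_ & (k & lt & _) & _); lia. }
(* Stage [k + 1] has length above [k], so its value at [k] is final. *)
set (S k := fst (s (k + 1)) k).
assert (HS : forall t, agree (snd (s t)) (fst (s t)) S).
{ intros t k lt; unfold S; destruct (le_lt_dec t (k + 1)) as [le|lt'].
  - apply (Hext _ _ le); auto.
  - symmetry; apply (Hext (k + 1) t); [lia|]; generalize (Hlen (k + 1)); lia. }
assert (SB : subset S B).
{ intros k Hk; apply (Hsub (k + 1)); auto; generalize (Hlen (k + 1)); lia. }
destruct (HC S) as [e He]; auto.
{ intros n; destruct (Hs n (Hsub n)) as (_ & (k & lt & Hk) & _).
  exists k; split; [generalize (Hlen n); lia|].
  rewrite <- (HS (Datatypes.S n)); auto; lia. }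
set (t := Datatypes.S (enc e)).
destruct (Hs (enc e) (Hsub _)) as (_ & _ & HK); specialize (HK e eq_refl); fold t in HK.
destruct HK as (y & [(v & ne & Hv)|H]).
- apply ne, (eval_deterministic S e [y]); auto.
- destruct (eval_use _ _ _ _ (He y)) as [u Hu].
  apply (H S (snd (s t) + u) (if C y then 1 else 0)).
  + repeat split; [lia|apply HS|]; intros k _; apply SB.
  + intros X' HX'; apply Hu, (agree_le _ (snd (s t) + u)); auto; lia.
Qed.

Lemma no_common_computable_subset : exists A B : setN,
  infinite A /\ infinite B /\
  (forall S, infinite S -> subset S B -> forall x, apply_op union_op S x <-> A x = true) /\
  ~ exists C, infinite C /\ subset C A /\
    forall S, infinite S -> subset S B -> computes S C.
Proof.
(* Stage [t] settles the code [e] with the string of length [m] given by the digits of [N], for the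
   triple coded by [t]. *)
destruct (sequence_of_steps (fun t p q => valid p -> valid q /\ state_ext p q /\
  bound p < bound q /\
  (exists b x, In b (elts q) /\ bound p <= b /\ bound p <= x /\ Nat.testbit b x = true) /\
  forall e N m, t = cpair (enc e) (cpair N m) -> settles e (Nat.testbit N) m p q)
  (State [] [] 0)) as [s [s0 Hs]].
{ intros t p; destruct (classic (valid p)) as [V|V]; [|exists p; tauto].
  assert (H : exists q, valid q /\ state_ext p q /\
    forall e N m, t = cpair (enc e) (cpair N m) -> settles e (Nat.testbit N) m p q).
  { destruct (classic (exists e N m, t = cpair (enc e) (cpair N m)))
      as [(e & N & m & E)|H].
    - destruct (settle e (Nat.testbit N) m p V) as (q & Vq & Eq & Hq).
      exists q; split; [auto|split; [auto|]]; intros e' N' m' E'; rewrite E in E'.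
      apply cpair_inj in E' as [E1 E2]; apply cpair_inj in E2 as [<- <-].
      apply enc_inj in E1; subst; auto.
    - exists p; split; [auto|split; [apply state_ext_refl|]].
      intros e N m E; exfalso; eauto. }
  destruct H as (q & Vq & Eq & Hq); destruct (grow_state q Vq) as (r & Vr & Er & lt & b & x & H).
  exists r; intros _; split; [auto|split; [eapply state_ext_trans; eauto|]].
  assert (bound p <= bound q) by apply Eq.
  split; [lia|split].
  - exists b, x; repeat split; try apply H; lia.
  - intros e N m E; eapply settles_ext; eauto. }
assert (V : forall t, valid (s t)).
{ induction t; [rewrite s0; intros b []|]; apply Hs; auto. }
assert (Ext : forall t u, t <= u -> state_ext (s t) (s u)).
{ induction 1 as [|u le IH]; [apply state_ext_refl|].
  eapply state_ext_trans; [exact IH|]; apply Hs; auto. }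
assert (Hlen : forall t, t <= bound (s t)).
{ induction t as [|t IH]; [lia|]; destruct (Hs t (V t)) as (_ & _ & lt & _); lia. }
set (B k := decide (exists t, In k (elts (s t)))).
set (A x := decide (exists k, B k = true /\ Nat.testbit k x = true)).
assert (Bnew : forall t k, bound (s t) <= k -> B k = true -> legal (s t) k).
{ intros t k le Hk; apply decideP in Hk as [u Hu].
  destruct (le_lt_dec t u) as [le'|lt'].
  - destruct (Ext _ _ le') as (_ & _ & _ & H); destruct (H k Hu) as [Hk|]; auto.
    apply V in Hk; lia.
  - assert (I : In k (elts (s t))) by (apply (Ext u t); auto; lia).
    apply V in I; lia. }
assert (Bin : forall t k, In k (elts (s t)) -> B k = true).
{ intros t k H; apply decideP; eauto. }
assert (Bout : forall t k y, In y (outs (s t)) -> B k = true -> Nat.testbit k y = false).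
{ intros t k y Hy Hk; apply decideP in Hk as [u Hu].
  apply (V (t + u)); [apply (Ext u)|apply (Ext t)]; auto; lia. }
assert (Aout : forall t y, In y (outs (s t)) -> A y = true -> False).
{ intros t y Hy Ay; apply decideP in Ay as (k & Hk & E).
  rewrite (Bout t k y) in E; easy. }
exists A, B; split; [|split; [|split]].
- intros n; destruct (Hs n (V n)) as (_ & _ & _ & (b & x & Hb & _ & le & Hx) & _).
  exists x; split; [generalize (Hlen n); lia|]; apply decideP; eauto.
- intros n; destruct (Hs n (V n)) as (_ & _ & _ & (b & x & Hb & le & _) & _).
  exists b; split; [generalize (Hlen n); lia|]; eauto.
- intros S HS SB x; rewrite apply_union_op; split.
  + intros (j & Hj & Hx); apply decideP; eauto.
  + intros Ax; apply decideP in Ax as (k & Hk & Hx); apply decideP in Hk as [t Ht].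
    destruct (HS (bound (s t))) as (j & le & Hj); exists j; split; auto.
    destruct (Bnew t j le (SB j Hj)) as (_ & _ & H); eauto.
- intros (C & HC & CA & Hcomp).
  destruct (uniform_computation B C) as (e & X & m & XB & H1 & H2); auto.
  { intros n; destruct (Hs n (V n)) as (_ & _ & _ & (b & x & Hb & le & _) & _).
    exists b; split; [generalize (Hlen n); lia|]; eauto. }
  destruct (nat_of_finite (fun k => X k = true) m) as [N HN].
  set (t := cpair (enc e) (cpair N m)).
  destruct (Hs t (V t)) as (Vq & Eq & _ & _ & Hset); specialize (Hset e N m eq_refl).
  unfold settles in Hset.
  set (X0 := pad (Nat.testbit N) m) in Hset; set (M := max m (bound (s t))) in Hset.
  assert (E0 : string_ext (fun k => B k = true) X m X0 M).
  { repeat split; [lia| |].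
    - intros k lt; unfold X0; rewrite pad_lt by auto.
      apply Bool.eq_iff_eq_true; rewrite HN; tauto.
    - intros k lt; unfold X0; rewrite pad_ge by lia; discriminate. }
  assert (G1 : forall Y n y v, string_ext (fun k => B k = true) X0 M Y n -> conv e Y n y v ->
     v = if C y then 1 else 0).
  { intros Y n y v E; apply H1; eapply string_ext_trans; eauto. }
  assert (G2 : forall Y n y v, string_ext (fun k => In k (elts (s (Datatypes.S t)))) X0 M Y n ->
     conv e Y n y v -> v = if C y then 1 else 0).
  { intros Y n y v E; apply G1; revert E; apply string_ext_imp; eauto. }
  assert (L : forall Y n, string_ext (fun k => B k = true) X0 M Y n ->
     string_ext (legal (s t)) X0 M Y n).
  { intros Y n; apply string_ext_imp; intros k le; apply Bnew; lia. }
  destruct Hset as [H|[(y & Hy & H)|[(y & Y & n & Hy & H3 & H4)|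
    (y & Y & n & Y' & n' & v & H3 & H4 & H5 & H6 & ne)]]].
  (* [C] has an element [y] that is neither excluded nor, being above the bound, a digit of an old
     element; the uniform procedure must accept it. *)
  + destruct (list_bound (outs (s t))) as [o Ho].
    destruct (HC (o + bound (s t))) as (y & le & Cy).
    destruct (H2 X0 M y E0) as (Y & n & v & HY & Hv).
    assert (v = 1) as -> by (apply G1 in Hv; auto; rewrite Cy in Hv; auto).
    apply (H y Y n); auto.
    * intros I; apply Ho in I; lia.
    * intros c Hc; destruct (Nat.testbit c y) eqn:E; auto.
      apply testbit_lt in E; apply V in Hc; lia.
  (* Elements of [B] beyond the bound are legal and lack the digit [y], so the promised answer at
     [y] is one excluded by [H]. *)
  + destruct (H2 X0 M y E0) as (Y & n & v & HY & Hv).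
    apply (H Y n v); auto; generalize HY; apply string_ext_imp; intros k le Hk.
    split; [apply Bnew; auto; lia|eauto].
  + apply (Aout _ _ Hy), CA; apply G2 in H4; auto; destruct (C y); auto; discriminate.
  + apply G2 in H4; auto; apply G2 in H6; auto; congruence.
Qed.

(** * Part (a): ultrafilters *)

Definition ultrafilter (U : (nat -> Prop) -> Prop) : Prop :=
  (forall V W : nat -> Prop, (forall n, V n -> W n) -> U V -> U W) /\
  (forall V W, U V -> U W -> U (fun n => V n /\ W n)) /\
  (forall V, U V -> exists n, V n) /\
  (forall V, U V \/ U (fun n => ~ V n)).

(** The sets [R m] are nonempty and decreasing, hence generate a proper filter. *)
Lemma ultrafilter_containing (R : nat -> nat -> Prop) :
  (forall m, exists j, R m j) -> (forall m n j, m <= n -> R n j -> R m j) ->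
  exists U, ultrafilter U /\ forall m, U (R m).
Proof.
intros inh mono.
assert (PF : @filter.ProperFilter nat (fun V => exists m, forall j, R m j -> V j)).
{ split; [|split].
  - intros [m H]; destruct (inh m) as [j Hj]; exact (H j Hj).
  - exists 0; exact (fun _ _ => I).
  - intros V W [m Hm] [n Hn]; exists (m + n); intros j Hj.
    split; [apply Hm|apply Hn]; apply (mono _ (m + n)); auto; lia.
  - intros V W VW [m Hm]; exists m; intros j Hj; apply VW, Hm, Hj. }
destruct (filter.ultraFilterLemma PF) as [U [HU FU]].
destruct (@filter.ultra_proper _ _ HU) as [U0 [UT UI US]].
exists U; split; [split; [|split; [|split]]|].
- intros V W; apply US.
- intros V W; apply UI.
- intros V HV; apply NNPP; intros NV; apply U0; apply (US V); auto.
  intros n Hn; apply NV; eauto.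
- intros V; exact (filter.in_ultra_setVsetC V HU).
- intros m; apply FU; exists m; auto.
Qed.

(** * Open games decided by an ultrafilter *)

Section Game.
Variables (U : (nat -> Prop) -> Prop) (HU : ultrafilter U).

Let U_imp := proj1 HU.
Let U_and := proj1 (proj2 HU).
Let U_inh := proj1 (proj2 (proj2 HU)).
Let U_or := proj2 (proj2 (proj2 HU)).

Lemma ultrafilter_true : U (fun _ => True).
Proof. destruct (U_or (fun _ => True)) as [H|H]; auto; revert H; apply U_imp; tauto. Qed.

Lemma ultrafilter_bounded (P : nat -> nat -> Prop) n :
  (forall m, U (P m)) -> U (fun j => forall m, m < n -> P m j).
Proof.
intros H; induction n as [|n IH].
- generalize ultrafilter_true; apply U_imp; lia.
- apply (U_imp (fun j => (forall m, m < n -> P m j) /\ P n j)); auto.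
  intros j [h1 h2] m lt; assert (m = n \/ m < n) as [->|] by lia; auto.
Qed.

(* [win G]: [U]-almost all choices of [n0], then [U]-almost all choices of [n1], etc.
   lead after finitely many steps to a sequence [n0; n1; ...] in [G]. *)
Inductive win : (list nat -> Prop) -> Prop :=
| win_now G : G [] -> win G
| win_step (G : list nat -> Prop) V :
    U V -> (forall n, V n -> win (fun l => G (n :: l))) -> win G.

Definition segment (S : setN) (a n : nat) : list nat := filter S (seq a (n - a)).

(** [W] is a strategy: it assigns to each finite history the set of moves allowed next. *)
Definition follows (W : list nat -> nat -> Prop) (a : nat) (S : setN) : Prop :=
  forall n, a <= n -> S n = true -> W (segment S a n) n.

Lemma segment_split S a b n : a <= b <= n -> segment S a n = segment S a b ++ segment S b n.
Proof.
intros le; unfold segment; rewrite <- filter_app; f_equal.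
replace (n - a) with ((b - a) + (n - b)) by lia; rewrite seq_app; do 2 f_equal; lia.
Qed.

Lemma segment_nil S a n : (forall k, a <= k < n -> S k = false) -> segment S a n = [].
Proof.
intros H; unfold segment; destruct (filter S (seq a (n - a))) as [|k l] eqn:E; auto.
assert (I : In k (filter S (seq a (n - a)))) by (rewrite E; simpl; auto).
apply filter_In in I as [I Hk]; apply in_seq in I; rewrite H in Hk; [discriminate|lia].
Qed.

Lemma segment_one S n : S n = true -> segment S n (n + 1) = [n].
Proof. intros H; unfold segment; replace (n + 1 - n) with 1 by lia; simpl; rewrite H; auto. Qed.

Lemma in_segment S a n k : In k (segment S a n) <-> a <= k < n /\ S k = true.
Proof. unfold segment; rewrite filter_In, in_seq; split; intros [h1 h2]; split; auto; lia. Qed.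

Lemma segment_agree S T a n : (forall k, a <= k < n -> S k = T k) -> segment S a n = segment T a n.
Proof.
intros H; unfold segment; apply filter_ext_in; intros k Hk; apply in_seq in Hk; apply H; lia.
Qed.

Lemma least_above (S : setN) a : (exists n, a <= n /\ S n = true) ->
  exists n, a <= n /\ S n = true /\ forall k, a <= k < n -> S k = false.
Proof.
intros (n & le & Hn); revert le Hn; induction n as [n IH] using lt_wf_ind; intros le Hn.
destruct (classic (exists k, a <= k < n /\ S k = true)) as [(k & lt & Hk)|H].
- apply (IH k); auto; lia.
- exists n; repeat split; auto; intros k lt; destruct (S k) eqn:E; auto.
  exfalso; eauto.
Qed.

Lemma follows_tail W a S n : a <= n -> S n = true -> (forall k, a <= k < n -> S k = false) ->
  follows W a S -> follows (fun l => W (n :: l)) (n + 1) S.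
Proof.
intros le Hn H HW k le' Hk; generalize (HW k ltac:(lia) Hk).
rewrite (segment_split S a n), (segment_split S n (n + 1)), segment_nil, segment_one; auto; lia.
Qed.

(** By induction on [win]: the first move is taken in [V], and the strategy chosen for that move
    goes on. *)
Lemma win_strategy G : win G -> exists W, (forall l, U (W l)) /\
  forall S a, infinite S -> follows W a S -> exists n, G (segment S a n).
Proof.
induction 1 as [G HG|G V HV _ IH].
- exists (fun _ _ => True); split; [intros; apply ultrafilter_true|].
  intros S a _ _; exists a; unfold segment; rewrite Nat.sub_diag; auto.
- destruct (choice (fun n W => V n -> (forall l, U (W l)) /\ forall S a, infinite S ->
    follows W a S -> exists m, G (n :: segment S a m))) as [F HF].
  { intros n; destruct (classic (V n)) as [Vn|Vn].
    - destruct (IH n Vn) as [W HW]; eauto.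
    - exists (fun _ _ => True); tauto. }
  exists (fun l => match l with
    | [] => V
    | n :: l => if excluded_middle_informative (V n) then F n l else fun _ => True end).
  split.
  + intros [|n l]; auto; destruct excluded_middle_informative; [apply HF; auto|].
    apply ultrafilter_true.
  + intros S a HS HW; destruct (least_above S a (HS a)) as (n & le & Hn & H).
    assert (Vn : V n) by (generalize (HW n le Hn); rewrite segment_nil; auto).
    destruct (HF n Vn) as [_ Fn].
    destruct (Fn S (n + 1) HS) as [m Hm].
    * generalize (follows_tail _ a S n le Hn H HW).
      destruct excluded_middle_informative; easy.
    (* The maximum keeps the first move [n] in the segment even if [m <= n]. *)
    * exists (max (n + 1) m); rewrite (segment_split S a n), (segment_split S n (n + 1)),
        segment_nil, segment_one by (auto; lia).
      replace (segment S (n + 1) (max (n + 1) m)) with (segment S (n + 1) m); auto.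
      unfold segment; do 2 f_equal; lia.
Qed.

Lemma win_ext G G' : (forall l, G l -> G' l) -> win G -> win G'.
Proof.
intros H W; revert G' H; induction W as [G HG|G V HV _ IH]; intros G' H.
- apply win_now; auto.
- apply win_step with V; auto; intros n Vn; apply (IH n Vn); auto.
Qed.

(** From a position that is not won, almost all moves lead to such positions again, by [win_step];
    by [win_now] these are outside [G]. [S] may be finite. *)
Lemma not_win_strategy G : ~ win G -> exists W, (forall l, U (W l)) /\
  forall S a, follows W a S -> forall n, ~ G (segment S a n).
Proof.
intros NG.
exists (fun l n => ~ win (fun t => G (l ++ t)) -> ~ win (fun t => G (l ++ n :: t))); split.
- intros l; destruct (classic (win (fun t => G (l ++ t)))) as [Hl|Hl].
  { generalize ultrafilter_true; apply U_imp; tauto. }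
  destruct (U_or (fun n => win (fun t => G (l ++ n :: t)))) as [H|H].
  + destruct Hl; apply (win_step _ _ H); auto.
  + revert H; apply U_imp; auto.
- intros S a HW n Hn.
  assert (H : forall m, ~ win (fun t => G (segment S a (a + m) ++ t))).
  { induction m as [|m IH].
    - unfold segment; rewrite Nat.add_0_r, Nat.sub_diag; auto.
    - rewrite (segment_split S a (a + m)) by lia; destruct (S (a + m)) eqn:E.
      + replace (a + Datatypes.S m) with (a + m + 1) by lia; rewrite segment_one by auto.
        intros Wm; apply (HW (a + m)) in IH; auto; [|lia].
        apply IH; revert Wm; apply win_ext; intros l; rewrite <- app_assoc; auto.
      + rewrite (segment_nil S (a + m)), app_nil_r; auto.
        intros k lt; assert (k = a + m) as -> by lia; auto. }
  apply (H (n - a)), win_now; rewrite app_nil_r.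
  replace (segment S a (a + (n - a))) with (segment S a n); auto.
  unfold segment; do 2 f_equal; lia.
Qed.

Lemma strategy G : exists W, (forall l, U (W l)) /\
  (win G -> forall S a, infinite S -> follows W a S -> exists n, G (segment S a n)) /\
  (~ win G -> forall S a, follows W a S -> forall n, ~ G (segment S a n)).
Proof.
destruct (classic (win G)) as [H|H].
- destruct (win_strategy G H) as (W & H1 & H2); exists W; split; [|split]; tauto.
- destruct (not_win_strategy G H) as (W & H1 & H2); exists W; split; [|split]; tauto.
Qed.
End Game.

(** * True facts and the diagonalization *)

Lemma segment_stop S a n m : n <= m -> (forall k, n <= k < m -> S k = false) ->
  segment S a n = segment S a m.
Proof.
intros le H; destruct (le_lt_dec a n) as [le'|lt].
- rewrite (segment_split S a n m), (segment_nil S n m), app_nil_r; auto; lia.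
- rewrite !segment_nil; auto; intros k; [intros; apply H|]; lia.
Qed.

Lemma lt_pow2_of_bits N n : (forall k, Nat.testbit N k = true -> k < n) -> N < 2 ^ n.
Proof.
intros H; destruct (Nat.eq_dec N 0) as [->|ne].
- generalize (Nat.pow_nonzero 2 n); lia.
- assert (lt := H _ (Nat.bit_log2 N ne)).
  destruct (Nat.log2_spec N) as [_ h]; [lia|].
  apply Nat.lt_le_trans with (1 := h), Nat.pow_le_mono_r; lia.
Qed.

Lemma last_below (S : setN) b n : b < n -> exists c, b <= c < n /\ (c = b \/ S c = true) /\
  forall k, c < k < n -> S k = false.
Proof.
induction n as [|n IH]; intros lt; [lia|].
destruct (Nat.eq_dec b n) as [->|ne]; [exists n; repeat split; auto; lia|].
destruct (S n) eqn:E; [exists n; repeat split; auto; lia|].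
destruct IH as (c & lt' & Hc & H); [lia|]; exists c; repeat split; auto; try lia.
intros k lk; destruct (Nat.eq_dec k n) as [->|]; auto; apply H; lia.
Qed.

(* Diagonalization: [e] is evaluated at a number [x] that codes [e]. The use of the computation
   is bounded by the elements of [l]. *)
Definition accepts (x : nat) (l : list nat) : Prop :=
  exists e N, x = cpair (enc e) N /\
  forall X, (forall k m, In m l -> k <= m -> X k = Nat.testbit N k || decide (In k l)) ->
    eval X e [x] 0.

(** Only elements after some [s > x] count as moves, since the strategy for [x] is sure to be
    followed only there. The end [N] exceeds all digit positions of [N]. *)
Definition fact (w : nat) : Prop :=
  exists x N s, w = cpair x N /\ x < s /\ Nat.testbit N s = true /\
  accepts x (segment (Nat.testbit N) (s + 1) N).

Definition lists_facts (m j : nat) : Prop :=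
  m <= j /\ (forall w, Nat.testbit j (w + w) = true -> fact w) /\
  forall w, w < m -> fact w -> Nat.testbit j (w + w) = true.

Lemma lists_facts_inh m : exists j, lists_facts m j.
Proof.
(* The odd digit makes [j] exceed [m] without asserting a fact. *)
destruct (nat_of_finite (fun k => k = S (m + m) \/ exists w, k = w + w /\ fact w) (m + m + 2))
  as [j Hj].
assert (Hm : Nat.testbit j (S (m + m)) = true) by (apply Hj; split; [lia|auto]).
apply testbit_lt in Hm; exists j; split; [lia|split].
- intros w Hw; apply Hj in Hw as [_ [E|(v & E & Hv)]]; [lia|].
  replace w with v by lia; auto.
- intros w lt Hw; apply Hj; split; [lia|eauto].
Qed.

Lemma lists_facts_mono m n j : m <= n -> lists_facts n j -> lists_facts m j.
Proof.
intros le (h1 & h2 & h3); split; [lia|split; auto]; intros w lt; apply h3; lia.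
Qed.

Lemma initial_and_segment (S : setN) N b n :
  (forall k, Nat.testbit N k = true <-> k < b /\ S k = true) ->
  forall k, k < n -> S k = Nat.testbit N k || decide (In k (segment S b n)).
Proof.
intros HN k lt; apply Bool.eq_iff_eq_true.
rewrite Bool.orb_true_iff, decideP, in_segment, HN.
destruct (le_lt_dec b k); intuition lia.
Qed.

Lemma no_computing_subset : exists A B : setN,
  infinite A /\ infinite B /\
  (forall S, infinite S -> subset S B -> forall x, apply_op fact_op S x <-> A x = true) /\
  forall S, infinite S -> subset S B -> ~ computes S A.
Proof.
destruct (ultrafilter_containing lists_facts lists_facts_inh lists_facts_mono)
  as (U & HU & HR).
destruct (choice (fun x W => (forall l, U (W l)) /\
  (win U (accepts x) -> forall S a, infinite S -> follows W a S ->
     exists n, accepts x (segment S a n)) /\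
  (~ win U (accepts x) -> forall S a, follows W a S -> forall n, ~ accepts x (segment S a n))))
  as [W HW].
{ intros x; exact (strategy U HU (accepts x)). }
(* [g b] bounds [b], the numbers of all subsets [N] of the initial segment up to [b], and
   [cpair (enc e) N] for such [N] when [enc e <= b]. *)
set (g b := cpair b (2 ^ (b + 1))).
(* After [b], the move [b'] obeys the strategies for all [x <= g b] and all histories up to [b];
   these finitely many conditions define a set of [U]. *)
set (V b b' := lists_facts (b + 1) b' /\ forall x, x < S (g b) -> forall N, N < S (g b) ->
  forall a, a < b + 2 -> W x (segment (Nat.testbit N) a (b + 1)) b').
assert (HV : forall b, U (V b)).
{ intros b; apply (proj1 (proj2 HU)); auto.
  apply (ultrafilter_bounded U HU (fun x b' => forall N, N < S (g b) ->
    forall a, a < b + 2 -> W x (segment (Nat.testbit N) a (b + 1)) b')); intros x.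
  apply (ultrafilter_bounded U HU (fun N b' =>
    forall a, a < b + 2 -> W x (segment (Nat.testbit N) a (b + 1)) b')); intros N.
  apply (ultrafilter_bounded U HU (fun a b' =>
    W x (segment (Nat.testbit N) a (b + 1)) b')); intros a.
  apply HW. }
destruct (sequence_of_steps (fun _ p q => forall c, c < S p -> V c q) 0) as [s [_ Hs]].
{ intros _ p; apply (proj1 (proj2 (proj2 HU))), ultrafilter_bounded; auto. }
assert (inc : forall t u, t < u -> s t < s u).
{ assert (h : forall t, s t < s (S t)).
  { intros t; destruct (Hs t (s t)) as [[le _] _]; lia. }
  induction 1 as [|u lt IH]; [apply h|generalize (h u); lia]. }
assert (Hlen : forall t, t <= s t).
{ induction t as [|t IH]; [lia|]; generalize (inc t (S t)); lia. }
set (B n := decide (exists t, n = s (S t))).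
assert (BV : forall b b', B b = true -> B b' = true -> b < b' -> V b b').
{ intros b b' Hb Hb' lt; apply decideP in Hb as [t ->]; apply decideP in Hb' as [u ->].
  apply Hs; destruct (le_lt_dec u t) as [le|lt'].
  - destruct (Nat.eq_dec u t) as [->|ne]; [lia|].
    generalize (inc (S u) (S t)); lia.
  - destruct (Nat.eq_dec (S t) u) as [->|ne]; [lia|generalize (inc (S t) u); lia]. }
assert (BF : forall b w, B b = true -> Nat.testbit b (w + w) = true -> fact w).
{ intros b w Hb; apply decideP in Hb as [t ->]; destruct (Hs t 0) as [(_ & H & _) _]; auto; lia. }
assert (gmono : forall b c, b <= c -> g b <= g c).
{ intros b c le; apply cpair_mono; auto; apply Nat.pow_le_mono_r; lia. }
(* All subsets of [B] follow the strategies, because [V] treats every history. Before a move [n],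
   the history ends at the last element [c] of [T] after [b], or at [b], and [V c n] applies. *)
assert (BW : forall T b x, subset T B -> B b = true -> x <= g b -> follows (W x) (b + 1) T).
{ intros T b x TB Hb le n ln Hn.
  destruct (last_below T b n) as (c & lc & Hc & H); [lia|].
  assert (Bc : B c = true) by (destruct Hc as [->|Hc]; auto).
  rewrite <- (segment_stop T (b + 1) (c + 1) n) by (try lia; intros; apply H; lia).
  destruct (nat_of_finite (fun k => T k = true) (c + 1)) as [N HN].
  replace (segment T (b + 1) (c + 1)) with (segment (Nat.testbit N) (b + 1) (c + 1)).
  - destruct (BV c n) as [_ HVc]; auto; [lia|]; apply HVc; try lia.
    + generalize (gmono b c); lia.
    + apply Nat.lt_succ_r, Nat.le_trans with (2 ^ (c + 1)); [|apply cpair_ge].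
      apply Nat.lt_le_incl, lt_pow2_of_bits; intros k Hk; apply HN in Hk; tauto.
  - apply segment_agree; intros k lk; apply Bool.eq_iff_eq_true; rewrite HN.
    split; [tauto|split; auto; lia]. }
exists (fun x => decide (win U (accepts x))), B; split; [|split; [|split]].
(* [CZero] answers 0 with every oracle, so all these numbers are accepted at once. *)
- intros n; exists (cpair (enc CZero) n); split; [apply cpair_ge|apply decideP, win_now].
  exists CZero, n; split; auto; intros; constructor.
- intros n; exists (s (S n)); split; [generalize (Hlen (S n)); lia|apply decideP; eauto].
- intros S HS SB x; rewrite apply_fact_op, decideP; split.
  (* If [x] is not in [A], the finite set coded by [N] follows the avoiding strategy after [c], so
     the listed fact would be false. *)
  + intros (j & N & Hj & HN & NS); apply NNPP; intros NW.
    destruct (BF j _ (SB j Hj) HN) as (x' & N' & c & E & lt & Hc & Hacc).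
    apply cpair_inj in E as [<- <-].
    destruct (HW x) as (_ & _ & H); apply (H NW (Nat.testbit N) (c + 1)) in Hacc; auto.
    apply BW; [intros k Hk; apply SB; auto|apply SB; auto|].
    generalize (cpair_ge c (2 ^ (c + 1))); fold (g c); lia.
  + intros Wx; destruct (HS (x + 1)) as (c & le & Hc).
    destruct (HW x) as (_ & H & _); destruct (H Wx S (c + 1)) as [n Hn]; auto.
    { apply BW; auto; generalize (cpair_ge c (2 ^ (c + 1))); fold (g c); lia. }
    destruct (nat_of_finite (fun k => S k = true) (max n (c + 1))) as [N HN].
    assert (E : segment (Nat.testbit N) (c + 1) N = segment S (c + 1) n).
    { rewrite (segment_stop _ (c + 1) N (max N (max n (c + 1)))); [|lia|].
      - rewrite <- (segment_stop _ (c + 1) (max n (c + 1)) (max N (max n (c + 1)))); [|lia|].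
        + replace (segment S (c + 1) n) with (segment S (c + 1) (max n (c + 1)))
            by (unfold segment; do 2 f_equal; lia).
          apply segment_agree; intros k lk; apply Bool.eq_iff_eq_true; rewrite HN.
          split; [tauto|split; auto; lia].
        + intros k lk; destruct (Nat.testbit N k) eqn:E; auto; apply HN in E; lia.
      - intros k lk; destruct (Nat.testbit N k) eqn:E; auto; apply testbit_lt in E; lia. }
    assert (F : fact (cpair x N)).
    { exists x, N, c; rewrite E; repeat split; auto; [lia|]; apply HN; split; auto; lia. }
    (* Any element of [B] after [d] lists all facts up to [d], in particular [cpair x N]. *)
    destruct (HS (cpair x N)) as (d & led & Hd); destruct (HS (d + 1)) as (j & lej & Hj).
    exists j, N; split; [auto|split].
    * destruct (BV d j) as [(_ & _ & HR') _]; auto; [lia|]; apply HR'; auto; lia.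
    * intros i Hi; apply HN in Hi; tauto.
- intros S HS SB [e He]; destruct (HS (enc e)) as (b & le & Hb).
  destruct (nat_of_finite (fun k => S k = true) (b + 1)) as [N HN].
  set (x := cpair (enc e) N); specialize (He x).
  assert (F : follows (W x) (b + 1) S).
  { apply BW; auto; apply cpair_mono; auto.
    apply Nat.lt_le_incl, lt_pow2_of_bits; intros k Hk; apply HN in Hk; tauto. }
  destruct (HW x) as (_ & H1 & H2).
  destruct (classic (win U (accepts x))) as [Wx|Wx].
  + rewrite (proj2 (decideP _) Wx) in He.
    destruct (H1 Wx S (b + 1) HS F) as (n & e' & N' & E & Hn).
    apply cpair_inj in E as [E <-]; apply enc_inj in E as <-.
    assert (E : 1 = 0); [|discriminate].
    apply (eval_deterministic S e [x]); auto; apply Hn; intros k m Hm lk.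
    apply in_segment in Hm; apply initial_and_segment; auto; lia.
  + assert (E : decide (win U (accepts x)) = false)
      by (apply Bool.not_true_is_false; rewrite decideP; auto).
    rewrite E in He; destruct (eval_use _ _ _ _ He) as [u Hu].
    destruct (HS (u + b + 1)) as (c & lc & Hc).
    (* [e] answers 0 on [S] with use [u]; a segment containing [c >= u] fixes the oracle that far
       and would be accepted. *)
    apply (H2 Wx S (b + 1) F (c + 1)); exists e, N; split; auto.
    intros X HX; apply Hu; intros k lk.
    rewrite (HX k c); [|apply in_segment; split; auto; lia|lia].
    apply initial_and_segment; auto; lia.
Qed.

Theorem theorem1p3 :
  (exists (A B : setN) (Theta : list bool -> nat -> Prop),
     infinite A /\ infinite B /\ rel_ce_operator Theta /\
     (forall S, infinite S -> subset S B ->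
        forall x, apply_op Theta S x <-> A x = true) /\
     ~ (exists C, infinite C /\ subset C B /\
          forall S, infinite S -> subset S C -> computes S A))
  /\
  (exists (A B : setN) (Theta : list bool -> nat -> Prop),
     infinite A /\ infinite B /\ rel_ce_operator Theta /\
     (forall S, infinite S -> subset S B ->
        forall x, apply_op Theta S x <-> A x = true) /\
     ~ (exists C, infinite C /\ subset C A /\
          forall S, infinite S -> subset S B -> computes S C)).
Proof.
split.
- destruct no_computing_subset as (A & B & HA & HB & HAB & H).
  exists A, B, fact_op; repeat split; auto using fact_op_ce; try (apply HAB; auto).
  (* Not even [C] itself computes [A]. *)
  intros (C & HC & CB & Hcomp); apply (H C); auto.
  apply Hcomp; auto; intros x; auto.
- destruct no_common_computable_subset as (A & B & HA & HB & HAB & H).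
  exists A, B, union_op; repeat split; auto using union_op_ce; apply HAB; auto.
Qed.
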